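(* Let $G=(V,E)$ be an undirected, connected graph. The set $B_G$ is a Gröbner basis of the toric ideal $I_{\mathcal{C}_G}$ with respect to every good term order on $R_G$.
   Context: Graphs are finite and undirected, and need not be simple. $ij$ denotes an undirected edge and $i\to j$ a directed edge. Cosmological polytope: with $x_i$ ($i\in V$), $x_e$ ($e\in E$) the standard basis of $\mathbb{R}^{|V|+|E|}$, $\mathcal{C}_G=\mathrm{conv}\{x_i+x_j-x_e,\ x_i-x_j+x_e,\ -x_i+x_j+x_e : e=ij\in E\}$. Polynomial ring: $R_G$ is the polynomial ring over a field $K$ in the $|V|+4|E|$ variables: $z_k$ for $k\in V\cup E$ ($z$-variables); $y_{ije}$ and $y_{jie}$ for each edge $e=ij\in E$ ($y$-variables); $t_e$ for each $e\in E$ ($t$-variables). Toric ideal: let $\varphi_G:R_G\to K[\mathbf{w}^p : p\in\mathcal{C}_G\cap\mathbb{Z}^{V\cup E}]$ be the surjective $K$-algebra homomorphism with $z_k\mapsto w_k$, and for $e=ij$, $y_{ije}\mapsto w_iw_j^{-1}w_e$, $y_{jie}\mapsto w_i^{-1}w_jw_e$, $t_e\mapsto w_iw_jw_e^{-1}$. Then $I_{\mathcal{C}_G}=\ker\varphi_G$. Zig-zag pairs: let $P$ be a path in $G$ with edges $i_1i_2,\dots,i_{k-1}i_k$, and let $(P_1,P_2)$ be a partition of $E(P)$ into two nonempty blocks. Put $E_1=\{i_j\to i_{j+1}: i_ji_{j+1}\in P_1\}$, $E_2=\{i_{j+1}\to i_j: i_ji_{j+1}\in P_2\}$. Then $(E_1,E_2)$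 is a zig-zag pair, with terminal vertices $v_1=i_k$, $v_2=i_1$. Its zig-zag binomial is $$b_{E_1,E_2}=z_{v_1}\prod_{e=i\to j\in E_1}y_{ije}\prod_{e=i\to j\in E_2}z_e-z_{v_2}\prod_{e=i\to j\in E_2}y_{ije}\prod_{e=i\to j\in E_1}z_e.$$ Cyclic pairs: let $C$ be a cycle in $G$ with edges $i_1i_2,\dots,i_{k-1}i_k,i_ki_1$, and let $(C_1,C_2)$ be a partition of $E(C)$ into two blocks (one possibly empty). Put $E_1=\{i_j\to i_{j+1}: i_ji_{j+1}\in C_1\}$ and $E_2=\{i_{j+1}\to i_j: i_ji_{j+1}\in C_2\}$ (indices cyclic). Then $(E_1,E_2)$ is a cyclic pair, with cyclic binomial $$b_{E_1,E_2}=\prod_{e=i\to j\in E_1}y_{ije}\prod_{e=i\to j\in E_2}z_e-\prod_{e=i\to j\in E_2}y_{ije}\prod_{e=i\to j\in E_1}z_e.$$ If $E_1=\emptyset$ or $E_2=\emptyset$, it is called a cycle binomial; it consists of one monomial only in $y$-variables and one only in $z$-variables. The fundamental binomials are, for each edge $e=ij\in E$: $$\underline{y_{ije}y_{jie}}-z_e^2,\ \ \underline{y_{ije}t_e}-z_i^2,\ \ \underline{y_{jie}t_e}-z_j^2,\ \ \underline{y_{ije}z_j}-z_iz_e,\ \ \underline{y_{jie}z_i}-z_jz_e,\ \ \underline{t_ez_e}-z_iz_j.$$ $B_G$ is the set consisting of all fundamental binomials together with all binomials $b_{E_1,E_2}$ for $(E_1,E_2)$ a zig-zag pair or a cyclic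 pair of $G$. A term order on $R_G$ is good if the leading terms of the fundamental binomials are the underlined monomials and the leading term of each cycle binomial is its monomial containing only $y$-variables. *)

(* Defs.v *)
From mathcomp Require Import all_boot all_order all_algebra.
From mathcomp.multinomials Require Import mpoly.

Set Implicit Arguments.
Unset Strict Implicit.
Unset Printing Implicit Defensive.

Import GRing.Theory.
Local Open Scope ring_scope.

(** Finite undirected multigraphs.  [endpt e false] and [endpt e true] are the
    two ends of [e]; they coincide when [e] is a loop.  The boolean only tells
    the two ends apart and is not part of the graph structure: everything below
    is invariant under exchanging them. *)
Record mgraph := MGraph {
  vertex : finType;
  edge : finType;
  endpt : edge -> bool -> vertex
}.

Section Graph.
Variable G : mgraph.

(** A dart is an edge with a direction: [(e, b)] is [e] traversed from
    [endpt e b] to its other end.  It encodes the directed edge [i -> j]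
    together with the underlying [e = ij]. *)
Definition dart : finType := (edge G * bool)%type.
Definition dsrc (d : dart) : vertex G := endpt d.1 d.2.
Definition dtgt (d : dart) : vertex G := endpt d.1 (~~ d.2).
Definition drev (d : dart) : dart := (d.1, ~~ d.2).
Definition dfollow : rel dart := [rel d d' | dtgt d == dsrc d'].

Definition adjacent : rel (vertex G) :=
  [rel u v | [exists d : dart, (dsrc d == u) && (dtgt d == v)]].
Definition connected : Prop := forall u v, connect adjacent u v.

(** [d :: p] is a path: consecutive darts that visit each vertex at most once. *)
Definition is_gpath (d : dart) (p : seq dart) : bool :=
  path dfollow d p && uniq (dsrc d :: map dtgt (d :: p)).

(** A loop is a cycle of length 1 and two parallel edges form a cycle of length
    2; the last condition only excludes going back and forth along one edge. *)
Definition is_gcycle (c : seq dart) : bool :=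
  [&& c != [::], cycle dfollow c, uniq (map dsrc c)
    & uniq [seq d.1 | d <- c]].

Definition edges_of (p : seq dart) : {set edge G} :=
  [set e in [seq d.1 | d <- p]].

Definition forward_darts (p : seq dart) (P1 : {set edge G}) : {set dart} :=
  [set d in p | d.1 \in P1].
Definition backward_darts (p : seq dart) (P2 : {set edge G}) : {set dart} :=
  [set drev d | d in [set d in p | d.1 \in P2]].

Definition zigzag_pair (E1 E2 : {set dart}) (v1 v2 : vertex G) : Prop :=
  exists (d : dart) (p : seq dart) (P1 P2 : {set edge G}),
    [/\ is_gpath d p,
        [/\ P1 != set0, P2 != set0, [disjoint P1 & P2]
          & P1 :|: P2 = edges_of (d :: p)],
        E1 = forward_darts (d :: p) P1,
        E2 = backward_darts (d :: p) P2
      & v1 = dtgt (last d p) /\ v2 = dsrc d].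

Definition cyclic_pair (E1 E2 : {set dart}) : Prop :=
  exists (c : seq dart) (C1 C2 : {set edge G}),
    [/\ is_gcycle c,
        [disjoint C1 & C2] /\ C1 :|: C2 = edges_of c,
        E1 = forward_darts c C1
      & E2 = backward_darts c C2].

(** Variables: [gvz k] for a vertex or edge [k]; [gvy d] for a dart [d = i -> j]
    on [e], which is y_{ije}; [gvt e]. *)
Definition gvar : finType := ((vertex G + edge G) + dart + edge G)%type.
Definition gvz (k : vertex G + edge G) : gvar := inl (inl k).
Definition gvy (d : dart) : gvar := inl (inr d).
Definition gvt (e : edge G) : gvar := inr e.

Lemma card_gvar : #|gvar| = (#|vertex G| + 4 * #|edge G|)%N.
Proof.
rewrite !card_sum card_prod card_bool -!addnA; congr addn.
by rewrite muln2 -addnn !mulSn mul0n addn0 -!addnA.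
Qed.

End Graph.

Section Ring.
Variables (K : fieldType) (G : mgraph).

(** [R_G]; the polynomial variable of [v : gvar G] is indexed by its rank. *)
Definition RG := {mpoly K[#|gvar G|]}.
Definition pvar (v : gvar G) : RG := 'X_(enum_rank v).
Definition zV (i : vertex G) : RG := pvar (gvz (inl i)).
Definition zE (e : edge G) : RG := pvar (gvz (inr e)).
Definition yD (d : dart G) : RG := pvar (gvy d).
Definition tE (e : edge G) : RG := pvar (gvt e).

(** The ring K[w^p : p in C_G, p integral] is a subring of the Laurent
    polynomial ring in the w_k, hence of the field of rational functions, which
    serves as codomain of [phi]; the kernel is the same. *)
Definition ratfun := {fraction {mpoly K[#|{: vertex G + edge G}|]}}.
Definition wvar (k : vertex G + edge G) : ratfun :=
  tofrac ('X_(enum_rank k) : {mpoly K[#|{: vertex G + edge G}|]}).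
Definition wV (i : vertex G) : ratfun := wvar (inl i).
Definition wE (e : edge G) : ratfun := wvar (inr e).
Definition wconst (c : K) : ratfun :=
  tofrac (c%:MP : {mpoly K[#|{: vertex G + edge G}|]}).

Definition phi_var (v : gvar G) : ratfun :=
  match v with
  | inl (inl k) => wvar k
  | inl (inr d) => wV (dsrc d) * (wV (dtgt d))^-1 * wE d.1
  | inr e => wV (endpt e false) * wV (endpt e true) * (wE e)^-1
  end.
Definition phi (f : RG) : ratfun :=
  mmap wconst (fun i => phi_var (enum_val i)) f.

Definition toric_ideal (f : RG) : Prop := phi f = 0.

(** [fundamental u v]: the binomial [u - v] is fundamental, with underlined
    monomial [u]. *)
Inductive fundamental : RG -> RG -> Prop :=
| Fund_yy e : fundamental (yD (e, false) * yD (e, true)) (zE e ^+ 2)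
| Fund_yt d : fundamental (yD d * tE d.1) (zV (dsrc d) ^+ 2)
| Fund_yz d : fundamental (yD d * zV (dtgt d)) (zV (dsrc d) * zE d.1)
| Fund_tz e : fundamental (tE e * zE e)
                          (zV (endpt e false) * zV (endpt e true)).

Definition yprod (D : {set dart G}) : RG := \prod_(d in D) yD d.
Definition zprod (D : {set dart G}) : RG := \prod_(d in D) zE d.1.

Definition zigzag_binomial (E1 E2 : {set dart G}) (v1 v2 : vertex G) : RG :=
  zV v1 * yprod E1 * zprod E2 - zV v2 * yprod E2 * zprod E1.
Definition cyclic_binomial (E1 E2 : {set dart G}) : RG :=
  yprod E1 * zprod E2 - yprod E2 * zprod E1.

Inductive BG : RG -> Prop :=
| BG_fundamental u v : fundamental u v -> BG (u - v)
| BG_zigzag E1 E2 v1 v2 :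
    zigzag_pair E1 E2 v1 v2 -> BG (zigzag_binomial E1 E2 v1 v2)
| BG_cyclic E1 E2 : cyclic_pair E1 E2 -> BG (cyclic_binomial E1 E2).

End Ring.

Section Groebner.
Variables (K : fieldType) (n : nat).
Implicit Types (f g t : {mpoly K[n]}) (I B : {mpoly K[n]} -> Prop).

(** A term order on K[x_0, ..., x_{n-1}], as a relation on exponents.  With
    finitely many variables it is automatically a well-order. *)
Definition term_order (le : rel 'X_{1..n}) : Prop :=
  [/\ total le, antisymmetric le, transitive le,
      forall m, le 0%MM m
    & forall m1 m2 m, le m1 m2 -> le (m1 + m)%MM (m2 + m)%MM].

(** [t] is the leading monomial of [f] (normalised to coefficient 1). *)
Definition is_lead (le : rel 'X_{1..n}) f t : Prop :=
  exists m : 'X_{1..n},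
    [/\ t = 'X_[m], m \in msupp f
      & forall m' : 'X_{1..n}, m' \in msupp f -> le m' m].

Definition ideal_gen (S : {mpoly K[n]} -> Prop) f : Prop :=
  exists s : seq ({mpoly K[n]} * {mpoly K[n]}),
    (forall cg, cg \in s -> S cg.2) /\ f = \sum_(cg <- s) cg.1 * cg.2.

Definition lead_ideal (le : rel 'X_{1..n}) (S : {mpoly K[n]} -> Prop) :=
  ideal_gen (fun t => exists2 f, S f & is_lead le f t).

Definition groebner_basis (le : rel 'X_{1..n}) I B : Prop :=
  [/\ exists s : seq {mpoly K[n]}, forall f, B f -> f \in s,
      forall f, B f -> I f
    & forall f, lead_ideal le I f <-> lead_ideal le B f].

End Groebner.

Definition good_order (K : fieldType) (G : mgraph)
    (le : rel 'X_{1..#|gvar G|}) : Prop :=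
  [/\ term_order le,
      forall u v : RG K G, fundamental u v -> is_lead le (u - v) u
    & forall E1 E2 : {set dart G}, cyclic_pair E1 E2 ->
        (E2 = set0 -> is_lead le (cyclic_binomial K E1 E2) (yprod K E1)) /\
        (E1 = set0 -> is_lead le (cyclic_binomial K E1 E2) (yprod K E2))].

(* Main.v *)
Require Import Defs.
From mathcomp Require Import all_boot all_order all_algebra zify.
From mathcomp.multinomials Require Import mpoly.

(** Why the theorem is true. The toric map sends every variable to a Laurent
    monomial of total degree 1, so an exponent shares its image with finitely
    many others, all of the same degree: its fibre. A polynomial of the kernel
    never has exactly one monomial in a given fibre. If the leading monomial x
    of a kernel element were divisible by no leading monomial of B_G, compare
    x with the least element y of its fibre: y is not divisible by one either,
    since its fibre contains nothing smaller. Removing the common factor of x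
    and y keeps these properties, so it suffices ([groebner_of_fibres]) to
    show: if x <> y lie in one fibre and have disjoint supports, then a
    leading monomial of B_G divides x or y.

    Suppose that no leading monomial of a fundamental binomial divides x or y.
    Comparing the exponents of w_e and using disjointness, neither x nor y
    contains a t-variable. Give the dart d = i -> j positive flow if y_d
    divides x or the y-variable of the reverse dart divides y. Comparing the
    exponents of w_i shows that at each vertex i the net outflow plus z_i(x) -
    z_i(y) is zero ([reduced_vertex]). Hence a positive dart can be continued
    by a positive dart, unless it enters a vertex whose z-variable divides x,
    and continued backwards unless it leaves a vertex whose z-variable divides
    y. A maximal path of positive darts then closes up to a cycle or runs from
    the second kind of vertex to the first ([pos_path_or_cycle]); if there is
    no positive dart at all, then x = y.

    Along this walk take as the first block S the edges whose y-variable
    divides x, and as T those for which no y-variable divides y; then T is a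
    subset of S. In the zig-zag or cyclic binomial with first block S the
    first monomial divides x; in the one with first block T the second
    monomial divides y. So one only needs that the first monomial leads for S
    or the second leads for T. Since y_{ije} y_{jie} > z_e^2, moving an edge
    out of the first block preserves that the first monomial is the smaller
    one ([lead_switch]), and one of the two cases always holds. On the path,
    the first dart lies in both first blocks and the last dart in neither,
    because y_{ije} z_j is a leading monomial; so both blocks are nonempty.

    Conversely the binomials of B_G vanish under the toric map because the
    sources and the targets of the darts of a walk telescope
    ([BG_in_toric_ideal]). *)

Set Implicit Arguments.
Unset Strict Implicit.
Unset Printing Implicit Defensive.

Import GRing.Theory.
Local Open Scope ring_scope.

(** * Term orders *)
Section TermOrder.
Variables (n : nat) (le : rel 'X_{1..n}).
Hypothesis hle : term_order le.
Implicit Types m : 'X_{1..n}.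

Let le_total : total le. Proof. by case: hle. Qed.
Let le_anti : antisymmetric le. Proof. by case: hle. Qed.
Let le_trans : transitive le. Proof. by case: hle. Qed.

Lemma term_order_refl : reflexive le.
Proof. by move=> m; case/orP: (le_total m m). Qed.

Lemma term_order_add2r m m1 m2 : le (m1 + m)%MM (m2 + m)%MM = le m1 m2.
Proof.
case: hle => _ _ _ _ leD; apply/idP/idP; last exact: leD.
move=> le12; case/orP: (le_total m1 m2) => // le21.
have /addIm-> : (m1 + m)%MM = (m2 + m)%MM.
  by apply: le_anti; rewrite le12 leD.
exact: term_order_refl.
Qed.

Lemma term_order_add2l m m1 m2 : le (m + m1)%MM (m + m2)%MM = le m1 m2.
Proof. by rewrite !(addmC m) term_order_add2r. Qed.

Lemma term_order_min (s : seq 'X_{1..n}) m :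
  m \in s -> exists2 m0, m0 \in s & {in s, forall m', le m0 m'}.
Proof.
elim: s m => // a s IHs m _; case: s IHs => [|b s] IHs.
  exists a; rewrite ?mem_head // => m'; rewrite inE => /eqP->.
  exact: term_order_refl.
have [m0 sm0 min0] := IHs b (mem_head _ _).
have [lea|leN] := boolP (le a m0).
  exists a; rewrite ?mem_head // => m'; rewrite inE => /predU1P[->|/min0].
    exact: term_order_refl.
  exact: le_trans.
exists m0; first by rewrite inE sm0 orbT.
move=> m'; rewrite inE => /predU1P[->|/min0//].
by case/orP: (le_total a m0) leN => [->|].
Qed.

Lemma is_lead_binomial (K : fieldType) m1 m2 :
  m1 != m2 -> le m2 m1 -> is_lead (K := K) le ('X_[m1] - 'X_[m2]) 'X_[m1].
Proof.
move=> neq le21; exists m1; split=> // [|m].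
  rewrite mcoeff_msupp mcoeffB !mcoeffX eqxx (eq_sym m2) (negPf neq) subr0.
  exact: oner_neq0.
rewrite mcoeff_msupp mcoeffB !mcoeffX; have [->|_] := eqVneq m1 m.
  by rewrite term_order_refl.
by have [<-//|] := eqVneq m2 m; rewrite subrr eqxx.
Qed.

Lemma is_lead_binomialC (K : fieldType) m1 m2 :
  m2 != m1 -> le m1 m2 -> is_lead (K := K) le ('X_[m1] - 'X_[m2]) 'X_[m2].
Proof.
move=> neq le12; have [m [em ms maxm]] := is_lead_binomial K neq le12.
have suppN : msupp ('X_[m1] - 'X_[m2] : {mpoly K[n]})
    =i msupp ('X_[m2] - 'X_[m1] : {mpoly K[n]}).
  by move=> m'; rewrite -(perm_mem (msuppN _)) opprB.
by exists m; split=> [//||m']; rewrite suppN //; apply: maxm.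
Qed.

Lemma is_lead_binomialE (K : fieldType) m1 m2 :
  is_lead (K := K) le ('X_[m1] - 'X_[m2]) 'X_[m1] -> m1 != m2 /\ le m2 m1.
Proof.
case=> m [eqm msm maxm].
have neq : m1 != m2 by apply: contraTneq msm => ->; rewrite subrr msupp0.
have /eqP : 'X_[m1]@_m1 = 'X_[m]@_m1 :> K by rewrite eqm.
rewrite !mcoeffX eqxx; have [em|_] := eqVneq m m1; last by rewrite oner_eq0.
split=> //; rewrite -em; apply: maxm.
rewrite mcoeff_msupp mcoeffB !mcoeffX eqxx (negPf neq) sub0r oppr_eq0.
exact: oner_neq0.
Qed.

End TermOrder.

(** * Kernels of monomial maps *)
Section Weight.
Variables (n k : nat) (w : 'I_n -> 'X_{1..k}).
Implicit Types x y : 'X_{1..n}.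

Definition weight x : 'X_{1..k} := (\sum_i w i *+ x i)%MM.

Lemma weightE x j : weight x j = (\sum_i w i j * x i)%N.
Proof. by rewrite /weight mnm_sumE; apply: eq_bigr => i _; rewrite mulmnE. Qed.

Lemma weightD x y : weight (x + y)%MM = (weight x + weight y)%MM.
Proof.
apply/mnmP=> j; rewrite mnmDE !weightE -big_split; apply: eq_bigr => i _.
by rewrite mnmDE mulnDr.
Qed.

Lemma weight0 : weight 0%MM = 0%MM.
Proof.
by apply/mnmP=> j; rewrite weightE big1 ?mnm0E // => i; rewrite mnm0E muln0.
Qed.

Lemma weightU i : weight U_(i)%MM = w i.
Proof.
rewrite /weight (bigD1 i) //= mnm1E eqxx mulm1n big1 ?addm0 // => i' /negPf i'i.
by rewrite mnm1E eq_sym i'i.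
Qed.

End Weight.

Section MonomialMap.
Variables (K : fieldType) (n k : nat) (num den : 'I_n -> 'X_{1..k}).
Implicit Types (m x y : 'X_{1..n}) (f : {mpoly K[n]}).

(** [num] and [den] are the exponents of numerator and denominator of the image
    of each variable; equality of the images of two monomials is written without
    subtraction by cross-multiplying. *)
Definition fibre x y :=
  (weight num x + weight den y)%MM == (weight num y + weight den x)%MM.

Definition laurent i : {fraction {mpoly K[k]}} :=
  tofrac ('X_[num i] : {mpoly K[k]}) / tofrac ('X_[den i] : {mpoly K[k]}).

Definition monomial_map : {mpoly K[n]} -> {fraction {mpoly K[k]}} :=
  mmap (@tofrac _ \o @mpolyC k K) laurent.

Lemma fibreP x y :
  fibre x y <-> (forall j, weight num x j + weight den y j
                           = weight num y j + weight den x j)%N.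
Proof.
split=> [/eqP/mnmP h j|h]; first by have := h j; rewrite !mnmDE.
by apply/eqP/mnmP=> j; rewrite !mnmDE.
Qed.

Lemma fibre_sym x y : fibre x y = fibre y x.
Proof. by rewrite /fibre eq_sym. Qed.

Lemma fibre_trans x y z : fibre x y -> fibre y z -> fibre x z.
Proof.
move=> /fibreP xy /fibreP yz; apply/fibreP => j.
by have := xy j; have := yz j; lia.
Qed.

(** This is what allows the common factor of two monomials to be removed. *)
Lemma fibreD2r z x y : fibre (x + z)%MM (y + z)%MM = fibre x y.
Proof.
rewrite /fibre !weightD -!addmA !(addmC (weight num z)) -!addmA.
by rewrite !addmA !eqm_add2r.
Qed.

Lemma tofracX_neq0 (a : 'X_{1..k}) : tofrac ('X_[a] : {mpoly K[k]}) != 0.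
Proof.
rewrite tofrac_eq0; apply/eqP=> /(congr1 (mcoeff a)) /eqP.
by rewrite mcoeffX eqxx mcoeff0 oner_eq0.
Qed.

Lemma monomial_mapX m :
  monomial_map 'X_[m]
    = tofrac ('X_[weight num m] : {mpoly K[k]})
      / tofrac ('X_[weight den m] : {mpoly K[k]}).
Proof.
rewrite /monomial_map mmapX /mmap1 /weight.
have XE := big_morph (fun a => 'X_[a]) (@mpolyXD k K) (@mpolyX0 k K).
rewrite !XE !rmorph_prod /=.
rewrite -prodfV -big_split /=; apply: eq_bigr => i _.
by rewrite /laurent exprMn exprVn -!mpolyXn !rmorphXn.
Qed.

Lemma monomial_map_fibre x y : fibre x y -> monomial_map ('X_[x] - 'X_[y]) = 0.
Proof.
move=> /eqP xy; rewrite /monomial_map mmapB -/monomial_map !monomial_mapX.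
apply/eqP; rewrite subr_eq0 eqr_div ?tofracX_neq0 //.
by rewrite -!tofracM -!mpolyXD xy.
Qed.

Lemma monomial_mapE f : monomial_map f =
  \sum_(m <- msupp f) tofrac (f@_m)%:MP_[k] * monomial_map 'X_[m].
Proof.
rewrite {1}/monomial_map /mmap; apply: eq_bigr => m _.
by rewrite /monomial_map mmapX.
Qed.

(** After clearing denominators with a single monomial [N], distinct fibres
    become distinct monomials of a polynomial ring, so the coefficients of [f]
    sum to zero over each fibre; a fibre cannot contribute one nonzero term. *)
Lemma monomial_map_eq0 f m : monomial_map f = 0 -> m \in msupp f ->
  exists2 m', m' \in msupp f & (m' != m) && fibre m m'.
Proof.
move=> f0 fm; pose N := (\sum_(x <- msupp f) weight den x)%MM.
have leN x : x \in msupp f -> (weight den x <= N)%MM.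
  move=> fx; rewrite /N (big_rem x) //=; exact: lem_addr.
pose a x := (weight num x + (N - weight den x))%MM.
have aE x y : x \in msupp f -> y \in msupp f -> a x = a y -> fibre x y.
  move=> fx fy /mnmP axy; apply/fibreP=> j; have := axy j.
  have /mnm_lepP/(_ j) := leN x fx; have /mnm_lepP/(_ j) := leN y fy.
  rewrite /a !mnmDE !mnmBE => ly lx e.
  by move: e lx ly; lia.
have : \sum_(x <- msupp f) f@_x *: 'X_[a x] = 0 :> {mpoly K[k]}.
  apply/eqP; rewrite -tofrac_eq0 rmorph_sum /=.
  have := mul0r (tofrac ('X_[N] : {mpoly K[k]})).
  rewrite -{1}f0 monomial_mapE mulr_suml => e0.
  apply/eqP; apply: etrans e0; apply: eq_big_seq => x fx.
  rewrite monomial_mapX -mul_mpolyC tofracM -mulrA.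
  congr (_ * _); rewrite -[in RHS](submK (leN x fx)) mpolyXD tofracM.
  rewrite mpolyXD tofracM (mulrC (tofrac 'X_[_ - _])) mulrA.
  by rewrite divfK ?tofracX_neq0.
move=> /(congr1 (mcoeff (a m))); rewrite mcoeff0 raddf_sum /=.
rewrite (bigD1_seq m) //= ?msupp_uniq // mcoeffZ mcoeffX eqxx mulr1 => e0.
have [/hasP[x fx /andP[xm /eqP ax]]|/hasPn no] :=
    boolP (has (fun x => (x != m) && (a x == a m)) (msupp f)).
  by exists x => //; rewrite xm aE.
move: e0; rewrite big_seq_cond big1 ?addr0 => [e0|x /andP[fx xm]].
  by move: fm; rewrite mcoeff_msupp e0 eqxx.
by have := no x fx; rewrite xm /= mcoeffZ mcoeffX => /negPf->; rewrite mulr0.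
Qed.

(** Finiteness of the fibres: they lie in one degree.  It replaces the
    well-foundedness of the term order in [groebner_of_fibres]. *)
Lemma mdeg_fibre x y : (forall i, mdeg (num i) = (mdeg (den i)).+1) ->
  fibre x y -> mdeg x = mdeg y.
Proof.
move=> hdeg /eqP/(congr1 mdeg); rewrite !mdegD.
suff numE z : mdeg (weight num z) = (mdeg (weight den z) + mdeg z)%N.
  by rewrite !numE; lia.
rewrite /weight !mdeg_sum mdegE -big_split /=; apply: eq_bigr => i _.
by rewrite !mdegMn hdeg mulSn addnC.
Qed.

(** A leading monomial [m] of the kernel and the least element [m0] of its fibre
    differ, because the fibre has an element below [m].  Divide both by their
    common factor and apply the hypothesis: the resulting divisor cannot divide
    [m0], as trading the leading monomial of an element of [B] for a smaller
    monomial of its fibre would produce something below [m0]. *)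
Theorem groebner_of_fibres (le : rel 'X_{1..n}) (I B : {mpoly K[n]} -> Prop) :
    term_order le ->
    (forall i, mdeg (num i) = (mdeg (den i)).+1) ->
    (forall f, I f <-> monomial_map f = 0) ->
    (exists s : seq {mpoly K[n]}, forall f, B f -> f \in s) ->
    (forall f, B f -> I f) ->
    (forall x y, fibre x y -> x != y -> (forall i, x i = 0%N \/ y i = 0%N) ->
       exists f l, [/\ B f, is_lead le f 'X_[l]
                       & (l <= x)%MM \/ (l <= y)%MM]) ->
  groebner_basis le I B.
Proof.
move=> hle hdeg IE finB BI Bdiv; split=> //.
have [le_tot le_anti le_trans _ _] := hle.
pose lead_div m := exists f l, [/\ B f, is_lead le f 'X_[l] & (l <= m)%MM].
have leadX f m : is_lead le f 'X_[m] ->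
    m \in msupp f /\ {in msupp f, forall m', le m' m}.
  case=> m1 [/(congr1 (mcoeff m))/eqP]; rewrite !mcoeffX eqxx.
  by have [->|_] := eqVneq m1 m; rewrite ?oner_eq0.
have lower f m : monomial_map f = 0 -> is_lead le f 'X_[m] ->
    exists m', [/\ m' != m, le m' m & fibre m m'].
  move=> f0 /leadX[fm maxm].
  have [m' fm' /andP[neq fib]] := monomial_map_eq0 f0 fm.
  by exists m'; split=> //; apply: maxm.
have lead_in f m : monomial_map f = 0 -> is_lead le f 'X_[m] -> lead_div m.
  move=> f0 lead; have [m' [neq le' fib']] := lower f m f0 lead.
  pose s := [seq x <- codom (@bmnm n (mdeg m).+1) | fibre m x].
  have sP x : (x \in s) = fibre m x.
    rewrite mem_filter andb_idr // => fx.
    have hx : (mdeg x < (mdeg m).+1)%N by rewrite (mdeg_fibre hdeg fx).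
    by apply/codomP; exists (BMultinom hx).
  have [m0 sm0 min0] := term_order_min hle (etrans (sP m') fib').
  have fib0 : fibre m m0 by rewrite -sP.
  (* The least element of a fibre is a standard monomial. *)
  have std0 : ~ lead_div m0.
    case=> g [l [Bg gl lm0]].
    have [l' [neql lel fibl]] := lower g l ((IE g).1 (BI g Bg)) gl.
    have e0 : (m0 = l + (m0 - l))%MM by rewrite addmC submK.
    have : le m0 (l' + (m0 - l))%MM.
      apply: min0; rewrite sP; apply: fibre_trans fib0 _.
      by rewrite {1}e0 fibreD2r.
    rewrite {1}e0 term_order_add2r // => lel'.
    by case/eqP: neql; apply: le_anti; rewrite lel lel'.
  (* [m] is not the least element, since [m'] lies below it. *)
  have neq0 : m != m0.
    apply: contraNneq neq => e; apply/eqP/le_anti; rewrite le' e min0 ?sP //.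
  pose x := (m - m0)%MM; pose y := (m0 - m)%MM.
  have em : (m = x + (m - x))%MM by rewrite addmC submK // lem_subr.
  have em0 : (m0 = y + (m - x))%MM.
    by apply/mnmP=> i; rewrite !mnmE -minnE minnC minnE addnC subnK ?leq_subr.
  have [| | |g [l [Bg gl [lx|ly]]]] := Bdiv x y.
  - by rewrite -(fibreD2r (m - x)) -em -em0.
  - by apply: contraNneq neq0 => exy; rewrite em em0 exy.
  - by move=> i; rewrite !mnmBE; case: (leqP (m i) (m0 i)) => h; [left|right];
      apply/eqP; rewrite subn_eq0 // ltnW.
  - by exists g, l; split=> //; apply: lepm_trans lx (lem_subr _ _).
  - by case: std0; exists g, l; split=> //; apply: lepm_trans ly (lem_subr _ _).
move=> f; split=> -[s [sgen ->]]; last first.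
  by exists s; split=> // cg /sgen[g /BI Ig gl]; exists g.
elim: s sgen => [_|[c t] s IHs sgen]; first by exists [::]; rewrite !big_nil.
have [|s' [sgen' es']] := IHs.
  by move=> cg cgs; apply: sgen; rewrite inE cgs orbT.
have [g /IE g0 gl] := sgen _ (mem_head _ _); rewrite /= in gl.
have [m [et gm maxm]] := gl; rewrite et in gl.
have [h [l [Bh hl lm]]] := lead_in g m g0 gl.
exists ((c * 'X_[m - l], 'X_[l]) :: s'); split=> [cg|].
  by rewrite inE => /predU1P[->|/sgen'//]; exists h.
by rewrite !big_cons es' /= et -mulrA -mpolyXD submK.
Qed.

End MonomialMap.

(** * Walks along positive darts *)
Section Darts.
Variable G : mgraph.
Implicit Types (d : dart G) (p c : seq (dart G)).

Lemma drevK : involutive (@drev G).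
Proof. by case=> e b; rewrite /drev /= negbK. Qed.

Lemma dsrc_drev d : dsrc (drev d) = dtgt d.
Proof. by []. Qed.

Lemma dtgt_drev d : dtgt (drev d) = dsrc d.
Proof. by rewrite -[in RHS](drevK d). Qed.

(** Reading the vertices of a walk from the sources or from the targets of its
    darts gives the same list: this is both the telescoping behind the zig-zag
    binomials and the symmetry between prefixes and suffixes of paths. *)
Lemma walk_vertices d p : path (@dfollow G) d p ->
  rcons (map (@dsrc G) (d :: p)) (dtgt (last d p))
    = dsrc d :: map (@dtgt G) (d :: p).
Proof.
elim: p d => //= d' p IHp d /andP[/eqP-> /IHp /=].
by move=> ->.
Qed.

Lemma gpathE d p : is_gpath d p =
  path (@dfollow G) d p
    && uniq (rcons (map (@dsrc G) (d :: p)) (dtgt (last d p))).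
Proof.
by rewrite /is_gpath; have [/walk_vertices->|] := boolP (path _ d p).
Qed.

Lemma gpath_uniq d p : is_gpath d p -> uniq (d :: p).
Proof. by move=> /andP[_]; rewrite cons_uniq => /andP[_ /map_uniq]. Qed.

Lemma gcycle_uniq c : is_gcycle c -> uniq c.
Proof. by case/and4P=> _ _ /map_uniq. Qed.

Lemma gpath_prefix d p q : is_gpath d (p ++ q) -> is_gpath d p.
Proof.
rewrite /is_gpath cat_path -cat_cons map_cat -(cat_cons (dsrc d)) cat_uniq.
by case/andP=> /andP[-> _] /and3P[].
Qed.

Lemma gpath_suffix d p q : is_gpath d (p ++ q) -> is_gpath (last d p) q.
Proof.
rewrite !gpathE cat_path -cat_cons last_cat lastI cat_rcons map_cat rcons_cat.
by rewrite cat_uniq => /andP[/andP[_ ->] /and3P[_ _ ->]].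
Qed.

Section Positive.
Variable pos : pred (dart G).
Hypothesis pos_rev : forall d, pos d -> ~~ pos (drev d).

(** The two darts of an edge are never both positive, so distinct positive
    darts lie on distinct edges. *)
Lemma pos_uniq_edges p : all pos p -> uniq p -> uniq [seq d.1 | d <- p].
Proof.
move=> /allP posp; rewrite map_inj_in_uniq // => -[e b] [e' b'].
move=> /posp pos1 /posp pos2 /= ee'; rewrite -{}ee' in pos2 *; congr (_, _).
by case: b b' pos1 pos2 => -[] // /pos_rev/negP.
Qed.

Lemma close_gpath d p d' : is_gpath d p -> all pos (d :: p) -> pos d' ->
    dsrc d' = dtgt (last d p) -> dtgt d' = dsrc d ->
  is_gcycle (rcons (d :: p) d') /\ all pos (rcons (d :: p) d').
Proof.
rewrite gpathE => /andP[pth unq] posp posd' src_d' tgt_d'.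
have posc : all pos (rcons (d :: p) d') by rewrite all_rcons posd'.
have unqc : uniq (map (@dsrc G) (rcons (d :: p) d')).
  by rewrite map_rcons src_d'.
split=> //; apply/and4P; split=> //.
- rewrite rcons_cons -[cycle _ _]/(path _ d (rcons (rcons p d') d)).
  rewrite !rcons_path pth last_rcons.
  by apply/andP; split; apply/eqP; rewrite ?src_d' ?tgt_d'.
- by apply: pos_uniq_edges posc _; apply: map_uniq unqc.
Qed.

Lemma loop_gcycle d : pos d -> dsrc d = dtgt d ->
  is_gcycle [:: d] /\ all pos [:: d].
Proof.
move=> posd loop; split; last by rewrite /= posd.
by apply/and4P; split=> //; rewrite /= andbT; apply/eqP.
Qed.

Variables source sink : pred (vertex G).
Hypothesis extend_fwd : forall d, pos d ->
  sink (dtgt d) \/ exists2 d', pos d' & dsrc d' = dtgt d.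
Hypothesis extend_bwd : forall d, pos d ->
  source (dsrc d) \/ exists2 d', pos d' & dtgt d' = dsrc d.

(** Extend a path of positive darts at both ends while possible.  A dart that
    returns to a vertex already visited closes a cycle with the part of the path
    between; otherwise the path grows, which the number of vertices bounds. *)
Lemma pos_path_or_cycle d : pos d ->
  (exists c, is_gcycle c /\ all pos c) \/
  (exists d1 p, [/\ is_gpath d1 p, all pos (d1 :: p), source (dsrc d1)
                  & sink (dtgt (last d1 p))]).
Proof.
move=> posd.
suff: forall n d p, is_gpath d p -> all pos (d :: p) ->
    (#|vertex G| <= n + size p)%N ->
  (exists c, is_gcycle c /\ all pos c) \/
  (exists d1 p, [/\ is_gpath d1 p, all pos (d1 :: p), source (dsrc d1)
                  & sink (dtgt (last d1 p))]).
  have [loop _|nloop] := eqVneq (dsrc d) (dtgt d).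
    by left; exists [:: d]; apply: loop_gcycle.
  move/(_ #|vertex G|%N d nil); apply; rewrite ?leq_addr //= ?posd //.
  by rewrite /is_gpath /= inE nloop.
elim=> [|n IHn] {posd}d p gp posp leV.
  case/andP: (gp) => _ /card_uniqP; rewrite /= size_map => cardp.
  have := max_card (mem (dsrc d :: map (@dtgt G) (d :: p))).
  by rewrite cardp => /leq_trans/(_ leV); rewrite add0n ltnNge leqnSn.
have poslast : pos (last d p) by apply: (allP posp); rewrite mem_last.
have posd : pos d by case/andP: posp.
have [snk|[d' posd' src_d']] := extend_fwd poslast; last first.
  have [|new] :=
    boolP (dtgt d' \in rcons (map (@dsrc G) (d :: p)) (dtgt (last d p))).
    rewrite mem_rcons inE => /predU1P[loop|/mapP[x xin tgt_d']].
      by left; exists [:: d']; apply: loop_gcycle => //; rewrite src_d' loop.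
    case/splitPl: p / xin gp posp {poslast leV} src_d'.
    move=> p1 p2 lastx gp posp src_d'.
    left; exists (rcons (last d p1 :: p2) d'); apply: close_gpath => //.
    - exact: gpath_suffix gp.
    - by move: posp; rewrite -cat_cons lastI cat_rcons all_cat => /andP[].
    - by rewrite src_d' last_cat.
    - by rewrite lastx.
  apply: (IHn d (rcons p d')).
  - rewrite gpathE rcons_path -andbA last_rcons -rcons_cons map_rcons rcons_uniq.
    have step : dfollow (last d p) d' by apply/eqP; rewrite src_d'.
    by rewrite src_d' new step /=; move: gp; rewrite gpathE.
  - by rewrite -rcons_cons all_rcons posd'.
  - by rewrite size_rcons; lia.
have [srs|[d' posd' tgt_d']] := extend_bwd posd.
  by right; exists d, p.
have [|new] := boolP (dsrc d' \in dsrc d :: map (@dtgt G) (d :: p)).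
  rewrite inE => /predU1P[loop|/mapP[x xin src_d']].
    by left; exists [:: d']; apply: loop_gcycle => //; rewrite tgt_d' loop.
  case/splitPl: p / xin gp posp {poslast leV snk} src_d'.
  move=> p1 p2 lastx gp posp src_d'.
  left; exists (rcons (d :: p1) d'); apply: close_gpath => //.
  - exact: gpath_prefix gp.
  - by move: posp; rewrite -cat_cons all_cat => /andP[].
  - by rewrite lastx.
apply: (IHn d' (d :: p)).
- case/andP: gp => pth unq; rewrite /is_gpath map_cons tgt_d' cons_uniq new unq.
  by rewrite /= pth !andbT; apply/eqP.
- by rewrite /= posd'.
- by rewrite [size _]/= addnS -addSn.
Qed.

End Positive.
End Darts.

(** * Zig-zag and cyclic binomials as differences of monomials *)
Section Monomials.
Variable G : mgraph.
Local Notation expo := 'X_{1..#|gvar G|}.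
Local Notation wexpo := 'X_{1..#|{: vertex G + edge G}|}.
Implicit Types (d : dart G) (p c : seq (dart G)) (S : {set edge G}).
Implicit Types (s : seq (gvar G)) (v : gvar G) (x : expo).

(** Lists of variables describe all monomials of B_G, and uniqueness of the list
    reduces divisibility to positivity of single exponents ([mon_le]). *)
Definition mon s : expo := (\sum_(v <- s) U_(enum_rank v))%MM.

Lemma mon_cons v s : mon (v :: s) = (U_(enum_rank v) + mon s)%MM.
Proof. by rewrite /mon big_cons. Qed.

Lemma monE s v : mon s (enum_rank v) = count_mem v s.
Proof.
rewrite /mon mnm_sumE -sum1_count [RHS]big_mkcond /=; apply: eq_bigr => u _.
by rewrite mnm1E (inj_eq enum_rank_inj); case: eqP.
Qed.

Lemma mon_le s x : uniq s -> {in s, forall v, 0 < x (enum_rank v)}%N ->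
  (mon s <= x)%MM.
Proof.
move=> us xs; apply/mnm_lepP => i.
rewrite -(enum_valK i) monE count_uniq_mem //.
by case: (boolP (_ \in s)) => // /xs.
Qed.

Lemma pvar_mon (K : fieldType) v : pvar K v = 'X_[mon [:: v]].
Proof. by rewrite /mon big_seq1. Qed.

Lemma prod_mon (K : fieldType) s : \prod_(v <- s) pvar K v = 'X_[mon s].
Proof.
by rewrite /mon (big_morph _ (@mpolyXD _ _) (@mpolyX0 _ _)).
Qed.

(** The first monomial, up to the terminal z-variable, of a zig-zag or cyclic
    binomial whose first block consists of the edges in [S].  The second monomial is the same construction for the
    reversed darts and the complement of [S], which makes the situation
    symmetric under exchanging the two monomials. *)
Definition dart_vars S p : seq (gvar G) :=
  [seq if d.1 \in S then gvy d else gvz (inr d.1) | d <- p].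

Lemma dart_vars_rev S p :
  dart_vars (~: S) (map (@drev G) p)
    = [seq if d.1 \in S then gvz (inr d.1) else gvy (drev d) | d <- p].
Proof.
rewrite /dart_vars -map_comp; apply: eq_map => d /=.
by rewrite inE; case: (d.1 \in S).
Qed.

(** Recovers the edges of a walk from [dart_vars], so that a walk with distinct
    edges yields distinct variables; vertex variables have no edge. *)
Definition edge_var v : option (edge G) :=
  match v with
  | inl (inl (inl _)) => None
  | inl (inl (inr e)) => Some e
  | inl (inr d) => Some d.1
  | inr e => Some e
  end.

Lemma edge_dart_vars S p :
  map edge_var (dart_vars S p) = map (fun d => Some d.1) p.
Proof. by rewrite -map_comp; apply: eq_map => d /=; case: ifP. Qed.

Lemma dart_vars_uniq S p : uniq [seq d.1 | d <- p] -> uniq (dart_vars S p).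
Proof.
move=> up; apply: (@map_uniq _ _ edge_var); rewrite edge_dart_vars.
by rewrite (map_comp Some) map_inj_uniq // => ? ? [].
Qed.

Lemma vertex_notin_dart_vars i S p : gvz (inl i) \notin dart_vars S p.
Proof. by apply/mapP=> -[d _]; case: ifP. Qed.

Lemma prod_forward (K : fieldType) (F : dart G -> RG K G) S p : uniq p ->
  \prod_(d in forward_darts p S) F d = \prod_(d <- p | d.1 \in S) F d.
Proof.
move=> up; rewrite -[RHS]big_filter [RHS]big_uniq ?filter_uniq //=.
by apply: eq_bigl => d; rewrite !inE mem_filter andbC.
Qed.

Lemma prod_backward (K : fieldType) (F : dart G -> RG K G) S p : uniq p ->
  \prod_(d in backward_darts p S) F d = \prod_(d <- p | d.1 \in S) F (drev d).
Proof.
move=> up; rewrite big_imset => [|? ? _ _ /(inv_inj (@drevK G))//].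
exact: (prod_forward (F \o @drev G)).
Qed.

Section Blocks.
Variables (K : fieldType) (p : seq (dart G)) (P1 P2 : {set edge G}).
Hypotheses (up : uniq p) (dis : [disjoint P1 & P2]).
Hypothesis cover : P1 :|: P2 = edges_of p.

Let P2E d : d \in p -> (d.1 \in P2) = (d.1 \notin P1).
Proof.
move=> dp; have : d.1 \in P1 :|: P2 by rewrite cover inE map_f.
rewrite inE; have [d1|//] := boolP (d.1 \in P1).
by rewrite (disjointFr dis d1).
Qed.

Lemma blocks_forward :
  yprod K (forward_darts p P1) * zprod K (backward_darts p P2)
    = 'X_[mon (dart_vars P1 p)].
Proof.
rewrite /yprod /zprod prod_forward // prod_backward // -prod_mon big_map.
rewrite [RHS](bigID (fun d => d.1 \in P1)) /=; congr (_ * _).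
  by apply: eq_bigr => d ->.
rewrite big_seq_cond [RHS]big_seq_cond; apply: eq_big => [d|d /andP[dp]].
  by case: (boolP (d \in p)) => //= dp; rewrite P2E.
by rewrite P2E // => /negPf->.
Qed.

Lemma blocks_backward :
  yprod K (backward_darts p P2) * zprod K (forward_darts p P1)
    = 'X_[mon (dart_vars (~: P1) (map (@drev G) p))].
Proof.
rewrite /yprod /zprod prod_forward // prod_backward // -prod_mon dart_vars_rev.
rewrite big_map [RHS](bigID (fun d => d.1 \in P1)) /= mulrC; congr (_ * _).
  by apply: eq_bigr => d ->.
rewrite big_seq_cond [RHS]big_seq_cond; apply: eq_big => [d|d /andP[dp]].
  by case: (boolP (d \in p)) => //= dp; rewrite P2E.
by rewrite P2E // => /negPf->.
Qed.

End Blocks.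

(** Common shape of both families: [a] and [b] are the terminal z-variables for
    a zig-zag pair and trivial for a cyclic pair. *)
Definition dart_binomial (K : fieldType) (a b : expo) S p : RG K G :=
  'X_[a + mon (dart_vars S p)]
    - 'X_[b + mon (dart_vars (~: S) (map (@drev G) p))].

Definition zvert (i : vertex G) : expo := mon [:: gvz (inl i)].

Lemma zigzag_binomialE (K : fieldType) d p (P1 P2 : {set edge G}) i j :
    is_gpath d p -> [disjoint P1 & P2] -> P1 :|: P2 = edges_of (d :: p) ->
  zigzag_binomial K (forward_darts (d :: p) P1) (backward_darts (d :: p) P2) i j
    = dart_binomial K (zvert i) (zvert j) P1 (d :: p).
Proof.
move=> gp dis cover; have up := gpath_uniq gp.
rewrite /zigzag_binomial /dart_binomial -!mulrA.
rewrite blocks_forward // blocks_backward //.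
by rewrite !mpolyXD -!pvar_mon.
Qed.

Lemma cyclic_binomialE (K : fieldType) c (C1 C2 : {set edge G}) :
    is_gcycle c -> [disjoint C1 & C2] -> C1 :|: C2 = edges_of c ->
  cyclic_binomial K (forward_darts c C1) (backward_darts c C2)
    = dart_binomial K 0 0 C1 c.
Proof.
move=> gc dis cover; have uc := gcycle_uniq gc.
rewrite /cyclic_binomial /dart_binomial !add0m.
by rewrite blocks_forward // blocks_backward.
Qed.

(** Hence the first block may be given as any set of edges, without reference
    to the walk. *)
Lemma dart_binomial_edges (K : fieldType) a b S p :
  dart_binomial K a b (S :&: edges_of p) p = dart_binomial K a b S p.
Proof.
have SE d : d \in p -> (d.1 \in S :&: edges_of p) = (d.1 \in S).
  by move=> dp; rewrite !inE map_f ?andbT.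
rewrite /dart_binomial !dart_vars_rev; congr ('X_[_ + mon _] - 'X_[_ + mon _]);
  by apply/eq_in_map => d dp; rewrite SE.
Qed.

Lemma split_edges S p :
  [disjoint S :&: edges_of p & edges_of p :\: S] /\
  (S :&: edges_of p) :|: (edges_of p :\: S) = edges_of p.
Proof.
split; last first.
  apply/setP=> e; rewrite in_setU in_setI in_setD.
  by case: (e \in S); rewrite /= ?orbF.
rewrite disjoints_subset; apply/subsetP=> e; rewrite in_setI => /andP[eS _].
by rewrite in_setC in_setD eS.
Qed.

Lemma BG_path (K : fieldType) d p S : is_gpath d p ->
    has (fun d' => d'.1 \in S) (d :: p) ->
    has (fun d' => d'.1 \notin S) (d :: p) ->
  BG (dart_binomial K (zvert (dtgt (last d p))) (zvert (dsrc d)) S (d :: p)).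
Proof.
move=> gp /hasP[d1 d1p d1S] /hasP[d2 d2p d2S]; rewrite -dart_binomial_edges.
have [dis cover] := split_edges S (d :: p).
rewrite -(zigzag_binomialE K _ _ gp dis cover); apply: BG_zigzag.
exists d, p, (S :&: edges_of (d :: p)), (edges_of (d :: p) :\: S).
split=> //; split=> //.
  by apply/set0Pn; exists d1.1; rewrite in_setI d1S inE map_f.
by apply/set0Pn; exists d2.1; rewrite in_setD d2S inE map_f.
Qed.

Lemma BG_cycle (K : fieldType) c S :
  is_gcycle c -> BG (dart_binomial K 0 0 S c).
Proof.
move=> gc; rewrite -dart_binomial_edges; have [dis cover] := split_edges S c.
rewrite -(cyclic_binomialE K gc dis cover); apply: BG_cyclic.
by exists c, (S :&: edges_of c), (edges_of c :\: S).
Qed.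

(** * The toric map and membership in its kernel *)
Definition wexp (k : vertex G + edge G) : wexpo := U_(enum_rank k)%MM.

Definition var_num v : wexpo :=
  match v with
  | inl (inl k) => wexp k
  | inl (inr d) => wexp (inl (dsrc d)) + wexp (inr d.1)
  | inr e => wexp (inl (endpt e false)) + wexp (inl (endpt e true))
  end%MM.

Definition var_den v : wexpo :=
  match v with
  | inl (inl k) => 0
  | inl (inr d) => wexp (inl (dtgt d))
  | inr e => wexp (inr e)
  end%MM.

Definition toric_num (i : 'I_#|gvar G|) : wexpo := var_num (enum_val i).
Definition toric_den (i : 'I_#|gvar G|) : wexpo := var_den (enum_val i).

Lemma toric_idealE (K : fieldType) (f : RG K G) :
  toric_ideal f <-> monomial_map toric_num toric_den f = 0.
Proof.
suff -> : monomial_map toric_num toric_den f = phi f by [].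
rewrite /phi /monomial_map /mmap; apply: eq_bigr => m _; congr (_ * _).
apply: eq_bigr => i _; congr (_ ^+ _); rewrite /laurent /toric_num /toric_den.
case: (enum_val i) => [[k|d]|e] /=.
- by rewrite mpolyX0 tofrac1 divr1.
- by rewrite mpolyXD tofracM mulrAC.
- by rewrite mpolyXD tofracM.
Qed.

Lemma mdeg_var v : mdeg (var_num v) = (mdeg (var_den v)).+1.
Proof. by case: v => [[k|d]|e] /=; rewrite ?mdegD ?mdeg0 !mdeg1. Qed.

Lemma weight_mon (w : gvar G -> wexpo) s :
  weight (fun i : 'I_#|gvar G| => w (enum_val i)) (mon s)
    = (\sum_(v <- s) w v)%MM.
Proof.
rewrite /mon (big_morph _ (weightD _) (weight0 _)).
by apply: eq_bigr => v _; rewrite weightU enum_rankK.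
Qed.

End Monomials.

Section Ideal.
Variables (K : fieldType) (G : mgraph).
Local Notation expo := 'X_{1..#|gvar G|}.
Implicit Types (d : dart G) (p c : seq (dart G)) (S : {set edge G}).

Definition toric_fibre : rel expo := fibre (@toric_num G) (@toric_den G).

Lemma binomial_in_toric_ideal (a b : expo) :
  toric_fibre a b -> toric_ideal (K := K) ('X_[a] - 'X_[b]).
Proof. by move=> ab; apply/toric_idealE/monomial_map_fibre. Qed.

Lemma toric_fibre_mon (s s' : seq (gvar G)) :
  (\sum_(v <- s) var_num v + \sum_(v <- s') var_den v)%MM
    = (\sum_(v <- s') var_num v + \sum_(v <- s) var_den v)%MM ->
  toric_fibre (mon s) (mon s').
Proof. by move=> e; rewrite /toric_fibre /fibre !weight_mon e. Qed.

(** The right-hand side does not depend on [S]: putting an edge into the other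
    block moves its contribution from one monomial to the other. *)
Lemma weight_dart_vars S p :
  (weight (@toric_num G) (mon (dart_vars S p))
     + weight (@toric_den G) (mon (dart_vars (~: S) (map (@drev G) p)))
   = \sum_(d <- p) wexp (inr d.1) + \sum_(d <- p) wexp (inl (dsrc d)))%MM.
Proof.
rewrite !weight_mon dart_vars_rev !big_map -!big_split /=.
apply: eq_bigr => d _; case: ifP => _ /=; first by rewrite addm0 addmC.
by rewrite dtgt_drev.
Qed.

Lemma toric_fibre_darts a b S p :
  (weight (@toric_num G) a + weight (@toric_den G) b
     + \sum_(d <- p) wexp (inl (dsrc d)) =
   weight (@toric_num G) b + weight (@toric_den G) a
     + \sum_(d <- p) wexp (inl (dtgt d)))%MM ->
  toric_fibre (a + mon (dart_vars S p))%MM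
              (b + mon (dart_vars (~: S) (map (@drev G) p)))%MM.
Proof.
have fwd := weight_dart_vars S p.
have bwd : (weight (@toric_num G) (mon (dart_vars (~: S) (map (@drev G) p)))
     + weight (@toric_den G) (mon (dart_vars S p))
   = \sum_(d <- p) wexp (inr d.1) + \sum_(d <- p) wexp (inl (dtgt d)))%MM.
  have := weight_dart_vars (~: S) (map (@drev G) p).
  by rewrite setCK (mapK (@drevK G)) !big_map.
move=> e; apply/fibreP => k; rewrite !weightD !mnmDE.
move/mnmP/(_ k): fwd; move/mnmP/(_ k): bwd; move/mnmP/(_ k): e.
by rewrite !mnmDE; lia.
Qed.

Lemma walk_sum (F : vertex G -> 'X_{1..#|{: vertex G + edge G}|}) d p :
    path (@dfollow G) d p ->
  (F (dtgt (last d p)) + \sum_(d' <- d :: p) F (dsrc d') =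
   F (dsrc d) + \sum_(d' <- d :: p) F (dtgt d'))%MM.
Proof.
move=> /walk_vertices/(congr1 (fun s => \sum_(i <- s) F i)%MM).
rewrite -cats1 big_cat big_seq1 big_cons !big_map => e.
by rewrite addmC; apply: e.
Qed.

Lemma cycle_sum (F : vertex G -> 'X_{1..#|{: vertex G + edge G}|}) c :
    cycle (@dfollow G) c ->
  (\sum_(d <- c) F (dsrc d) = \sum_(d <- c) F (dtgt d))%MM.
Proof.
case: c => [|d p] /=; first by rewrite !big_nil.
rewrite rcons_path => /andP[/(walk_sum F) e /eqP tgt].
by move: e; rewrite tgt => /addmI.
Qed.

Lemma fundamental_in_toric_ideal (u w : RG K G) :
  fundamental u w -> toric_ideal (u - w).
Proof.
have mon2 a b : 'X_[mon [:: a; b]] = pvar K a * pvar K b.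
  by rewrite -prod_mon !big_cons big_nil mulr1.
case=> [e|d|d|e]; rewrite ?expr2 -!mon2;
  apply/binomial_in_toric_ideal/toric_fibre_mon;
  rewrite !big_cons !big_nil; apply/mnmP=> k; rewrite !mnmDE ?mnm0E /=.
- by rewrite /dsrc /dtgt /= ?mnmDE ?mnm0E; lia.
- by rewrite /dsrc /dtgt; case: d.2; rewrite /= ?mnmDE ?mnm0E; lia.
- by rewrite ?mnmDE ?mnm0E; lia.
- by rewrite ?mnmDE ?mnm0E; lia.
Qed.

Lemma BG_in_toric_ideal f : BG f -> toric_ideal (K := K) (G := G) f.
Proof.
case=> {f} [u w|E1 E2 v1 v2|E1 E2].
- exact: fundamental_in_toric_ideal.
- case=> d [p [P1 [P2 [gp [_ _ dis cover] -> -> [-> ->]]]]].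
  rewrite zigzag_binomialE //; apply: binomial_in_toric_ideal.
  apply: toric_fibre_darts; rewrite !weight_mon !big_seq1 /= !addm0.
  by apply: (walk_sum (fun i => wexp (inl i))); case/andP: gp.
- case=> c [C1 [C2 [gc [dis cover] -> ->]]].
  rewrite cyclic_binomialE //; apply: binomial_in_toric_ideal.
  apply: toric_fibre_darts; rewrite !weight0 !add0m.
  by apply: (cycle_sum (fun i => wexp (inl i))); case/and4P: gc.
Qed.

Lemma BG_finite : exists s : seq (RG K G), forall f, BG f -> f \in s.
Proof.
exists ([seq yD K (e, false) * yD K (e, true) - zE K e ^+ 2 | e : edge G] ++
        [seq yD K d * tE K d.1 - zV K (dsrc d) ^+ 2 | d : dart G] ++
        [seq yD K d * zV K (dtgt d) - zV K (dsrc d) * zE K d.1 | d : dart G] ++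
        [seq tE K e * zE K e - zV K (endpt e false) * zV K (endpt e true)
           | e : edge G] ++
        [seq zigzag_binomial K u.1.1 u.1.2 u.2.1 u.2.2
           | u : ({set dart G} * {set dart G}) * (vertex G * vertex G)] ++
        [seq cyclic_binomial K u.1 u.2 | u : {set dart G} * {set dart G}]).
move=> f; rewrite !mem_cat; case=> {f} [u w [e|d|d|e]|E1 E2 v1 v2 _|E1 E2 _].
- by apply/orP; left; apply/imageP; exists e.
- by apply/orP; right; apply/orP; left; apply/imageP; exists d.
- by do 2!(apply/orP; right); apply/orP; left; apply/imageP; exists d.
- by do 3!(apply/orP; right); apply/orP; left; apply/imageP; exists e.
- do 4!(apply/orP; right); apply/orP; left; apply/imageP.
  by exists ((E1, E2), (v1, v2)).
- by do 5!(apply/orP; right); apply/imageP; exists (E1, E2).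
Qed.

End Ideal.

(** * The flow of two exponents in one fibre *)
Section ReducedPair.
Variable G : mgraph.
Local Notation expo := 'X_{1..#|gvar G|}.
Implicit Types (d : dart G) (p c : seq (dart G)) (S : {set edge G}).
Implicit Types x y : expo.

Definition expo_at x (v : gvar G) : nat := x (enum_rank v).
Local Notation zv x i := (expo_at x (gvz (inl i))).
Local Notation ze x e := (expo_at x (gvz (inr e))).
Local Notation yd x d := (expo_at x (gvy d)).
Local Notation te x e := (expo_at x (gvt e)).

Lemma toric_weightE (w : gvar G -> 'X_{1..#|{: vertex G + edge G}|}) x k :
  weight (fun i : 'I_#|gvar G| => w (enum_val i)) x (enum_rank k) =
  (\sum_(k' : vertex G + edge G) w (gvz k') (enum_rank k) * expo_at x (gvz k')
   + \sum_d w (gvy d) (enum_rank k) * yd x d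
   + \sum_e w (gvt e) (enum_rank k) * te x e)%N.
Proof.
rewrite weightE (reindex (@enum_rank (gvar G))) /=; last first.
  exact/onW_bij/enum_rank_bij.
rewrite !big_sumType /=; congr (_ + _ + _)%N; by
  [rewrite ?big_sumType; congr addn; apply: eq_bigr => v _; rewrite enum_rankK
  |apply: eq_bigr => v _; rewrite enum_rankK].
Qed.

Lemma wexpE (k k' : vertex G + edge G) : wexp k (enum_rank k') = (k == k').
Proof. by rewrite /wexp mnm1E (inj_eq enum_rank_inj). Qed.

Lemma sum_delta (T : finType) (a : T) (F : T -> nat) :
  (\sum_t (t == a) * F t = F a)%N.
Proof.
rewrite (bigD1 a) //= eqxx mul1n big1 ?addn0 // => t /negPf->.
by rewrite mul0n.
Qed.

Lemma sum_wexp k (F : vertex G + edge G -> nat) :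
  (\sum_k' wexp k' (enum_rank k) * F k' = F k)%N.
Proof.
by rewrite -[RHS](sum_delta k F); apply: eq_bigr => k' _; rewrite wexpE.
Qed.

Lemma sum_mnm0 (T : finType) k (F : T -> nat) :
  (\sum_t (0%MM : 'X_{1..#|{: vertex G + edge G}|}) k * F t = 0)%N.
Proof. by rewrite big1 // => t _; rewrite mnm0E. Qed.

Lemma sum_pred (T : finType) (P : pred T) (F : T -> nat) :
  (\sum_t P t * F t = \sum_(t | P t) F t)%N.
Proof.
rewrite [RHS]big_mkcond; apply: eq_bigr => t _.
by case: (P t); rewrite ?mul1n.
Qed.

Lemma sum_edge_darts e (F : dart G -> nat) :
  (\sum_(d | d.1 == e) F d = F (e, false) + F (e, true))%N.
Proof.
rewrite (bigD1 (e, false)) ?eqxx // (bigD1 (e, true)) /=; last first.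
  by rewrite xpair_eqE eqxx.
rewrite big1 ?addn0 // => -[e' b] /andP[/andP[/eqP/= ->]].
by case: b; rewrite eqxx.
Qed.

Lemma fibre_edge x y e : toric_fibre x y ->
  (ze x e + yd x (e, false) + yd x (e, true) + te y e
   = ze y e + yd y (e, false) + yd y (e, true) + te x e)%N.
Proof.
move/fibreP/(_ (enum_rank (inr e))); rewrite !toric_weightE /=.
rewrite !(sum_wexp (inr e) (fun k => expo_at _ (gvz k))) !sum_mnm0.
have yE x' : (\sum_d var_num (gvy d) (enum_rank (inr e)) * yd x' d
    = yd x' (e, false) + yd x' (e, true))%N.
  apply: (etrans _ (sum_edge_darts e (fun d => yd x' d))).
  rewrite -[RHS]sum_pred; apply: eq_bigr => d _.
  by rewrite mnmDE !wexpE.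
have tE x' : (\sum_e' wexp (inr e') (enum_rank (inr e)) * te x' e' = te x' e)%N.
  rewrite -(sum_delta e (fun e => te x' e)).
  by apply: eq_bigr => e' _; rewrite wexpE.
have y0 x' : (\sum_d wexp (inl (dtgt d)) (enum_rank (inr e)) * yd x' d = 0)%N.
  by rewrite big1 // => d _; rewrite wexpE.
have t0 x' : (\sum_e' var_num (gvt e') (enum_rank (inr e)) * te x' e' = 0)%N.
  by rewrite big1 // => e' _; rewrite mnmDE !wexpE.
by rewrite !yE !tE !y0 !t0; lia.
Qed.

(** Conservation at the vertex [i] of the flow that gives the dart [d] the value
    y_d(x) + y_{rev d}(y) minus the same expression with [x] and [y] exchanged;
    written without subtraction. *)
Lemma fibre_vertex x y i : toric_fibre x y ->
    (forall e, te x e = 0%N) -> (forall e, te y e = 0%N) ->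
  (zv x i + \sum_(d | dsrc d == i) (yd x d + yd y (drev d))
   = zv y i + \sum_(d | dsrc d == i) (yd y d + yd x (drev d)))%N.
Proof.
move=> + tx ty; move/fibreP/(_ (enum_rank (inl i))).
rewrite !toric_weightE /= !(sum_wexp (inl i) (fun k => expo_at _ (gvz k))).
rewrite !sum_mnm0.
have yE x' : (\sum_d var_num (gvy d) (enum_rank (inl i)) * yd x' d
    = \sum_(d | dsrc d == i) yd x' d)%N.
  rewrite -[RHS]sum_pred; apply: eq_bigr => d _.
  by rewrite mnmDE !wexpE addn0.
have yV x' : (\sum_d wexp (inl (dtgt d)) (enum_rank (inl i)) * yd x' d
    = \sum_(d | dsrc d == i) yd x' (drev d))%N.
  rewrite (reindex_inj (inv_inj (@drevK G))) -[RHS]sum_pred.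
  by apply: eq_bigr => d _; rewrite wexpE dtgt_drev.
have t0 (F : edge G -> nat) x' :
    (forall e, te x' e = 0%N) -> (\sum_e F e * te x' e = 0)%N.
  by move=> t0; rewrite big1 // => e _; rewrite t0 muln0.
by rewrite !yE !yV !t0 // !big_split /=; lia.
Qed.

(** No underlined monomial of a fundamental binomial divides [x]. *)
Definition fundamental_free x : Prop :=
  [/\ forall e, yd x (e, false) = 0%N \/ yd x (e, true) = 0%N,
      forall d, yd x d = 0%N \/ te x d.1 = 0%N,
      forall d, yd x d = 0%N \/ zv x (dtgt d) = 0%N
    & forall e, te x e = 0%N \/ ze x e = 0%N].

Definition reduced_pair x y : Prop :=
  [/\ toric_fibre x y, forall v, expo_at x v = 0%N \/ expo_at y v = 0%N,
      fundamental_free x & fundamental_free y].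

Lemma reduced_pair_sym x y : reduced_pair x y -> reduced_pair y x.
Proof.
case=> fib dis fx fy; split=> //; first by rewrite /toric_fibre fibre_sym.
by move=> v; case: (dis v); [right|left].
Qed.

(** On a reduced pair this says exactly that the flow of [fibre_vertex] is
    positive on [d]. *)
Definition flow_pos x y : pred (dart G) :=
  fun d => (0 < yd x d)%N || (0 < yd y (drev d))%N.

Definition y_edges x : {set edge G} :=
  [set e | (0 < yd x (e, false))%N || (0 < yd x (e, true))%N].

Lemma flow_pos_swap x y d : flow_pos y x d = flow_pos x y (drev d).
Proof. by rewrite /flow_pos drevK orbC. Qed.

Section Reduced.
Variables x y : expo.
Hypothesis red : reduced_pair x y.

(** If t_e divided [x], then no other variable of [e] would, so the exponent of
    w_e would be negative; then t_e would divide [y] as well. *)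
Lemma reduced_no_t e : te x e = 0%N /\ te y e = 0%N.
Proof.
case: red => fib dis [_ yt _ tz] [_ yt' _ tz'].
have := fibre_edge e fib; have := dis (gvt e); have := tz e; have := tz' e.
have := yt (e, false); have := yt (e, true).
by have := yt' (e, false); have := yt' (e, true); rewrite /=; lia.
Qed.

Lemma reduced_vertex i :
  (zv x i + \sum_(d | dsrc d == i) (yd x d + yd y (drev d))
   = zv y i + \sum_(d | dsrc d == i) (yd y d + yd x (drev d)))%N.
Proof.
by case: red => fib _ _ _; apply: fibre_vertex => // e; case: (reduced_no_t e).
Qed.

Lemma reduced_edge d : (ze x d.1 + yd x d + yd x (drev d)
   = ze y d.1 + yd y d + yd y (drev d))%N.
Proof.
have [[fib _ _ _] [tx ty]] := (red, reduced_no_t d.1).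
have := fibre_edge d.1 fib; rewrite tx ty.
by case: d {tx ty} => e [] /=; rewrite /drev /=; lia.
Qed.

Lemma flow_pos_rev d : flow_pos x y d -> ~~ flow_pos x y (drev d).
Proof.
case: red => _ dis [yy _ _ _] [yy' _ _ _].
rewrite -flow_pos_swap /flow_pos.
have := dis (gvy d); have := dis (gvy (drev d)).
by case: d => e [] /=; rewrite /drev /=; have := yy e; have := yy' e; lia.
Qed.

(** The reverse of [d] leaves the target of [d] with negative flow, so
    conservation demands a positive dart leaving it or a z-variable of [x]. *)
Lemma flow_extend d : flow_pos x y d ->
  (0 < zv x (dtgt d))%N \/ exists2 d', flow_pos x y d' & dsrc d' = dtgt d.
Proof.
move=> posd; have [|z0] := posnP (zv x (dtgt d)); [move=> z0; right | by left].
have := reduced_vertex (dtgt d).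
rewrite z0 add0n => e.
have [/existsP[d' /andP[/eqP src pos']]|no] :=
  boolP [exists d', (dsrc d' == dtgt d) && flow_pos x y d'].
  by exists d'.
(* Otherwise the left-hand side vanishes, while [drev d] contributes to the
   right-hand side. *)
move: e; rewrite big1 => [|d' src]; last first.
  move: no; rewrite negb_exists => /forallP/(_ d'); rewrite src /flow_pos /=.
  by lia.
rewrite (bigD1 (drev d)) /=; last by rewrite dsrc_drev.
by move: posd; rewrite drevK /flow_pos; lia.
Qed.

Lemma no_flow : (forall d, ~~ flow_pos x y d) -> x = y.
Proof.
move=> no; have [_ dis _ _] := red.
have y0 d : yd x d = 0%N /\ yd y d = 0%N.
  by have := no d; have := no (drev d); rewrite /flow_pos drevK; lia.
have zv0 i : zv x i = 0%N /\ zv y i = 0%N.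
  have := reduced_vertex i.
  rewrite !big1 => [|d _|d _]; first by have := dis (gvz (inl i)); lia.
    by rewrite (y0 d).2 (y0 (drev d)).1.
  by rewrite (y0 d).1 (y0 (drev d)).2.
have ze0 e : ze x e = 0%N /\ ze y e = 0%N.
  have := reduced_edge (e, true); have := dis (gvz (inr e)).
  by have := y0 (e, true); have := y0 (drev (e, true)); rewrite /=; lia.
have v0 v : expo_at x v = 0%N /\ expo_at y v = 0%N.
  case: v => [[[i|e]|d]|e];
    [exact: zv0|exact: ze0|exact: y0|exact: reduced_no_t].
apply/mnmP=> i; rewrite -(enum_valK i).
by have := v0 (enum_val i); rewrite /expo_at => -[-> ->].
Qed.

Lemma y_edgesP d : flow_pos x y d -> (d.1 \in y_edges x) = (0 < yd x d)%N.
Proof.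
move=> /flow_pos_rev; rewrite /flow_pos inE.
by case: d => e [] /=; rewrite /drev /=; lia.
Qed.

(** If y_d does not divide [x], the positive flow on [d] comes from [y], and [x]
    can match the exponent of w_e only through z_e. *)
Lemma flow_divides c : all (flow_pos x y) c ->
  {in dart_vars (y_edges x) c, forall v, 0 < expo_at x v}%N.
Proof.
move=> /allP posc v /mapP[d /posc posd ->]; rewrite y_edgesP //.
case: ifP => // /negbT; rewrite -eqn0Ngt => /eqP yx0.
have := flow_pos_rev posd; have [_ dis _ _] := red; have := reduced_edge d.
have := dis (gvy (drev d)); have := dis (gvz (inr d.1)).
by move: posd; rewrite /flow_pos drevK yx0; lia.
Qed.

(** The monomial y_d z_j, with j the target of [d], is a leading monomial. *)
Lemma flow_into_sink d : flow_pos x y d -> (0 < zv x (dtgt d))%N ->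
  d.1 \notin y_edges x.
Proof.
move=> posd; have [_ _ [_ _ yz _] _] := red; rewrite y_edgesP //.
by have := yz d; lia.
Qed.

End Reduced.
End ReducedPair.

(** * Leading monomials dividing one of two exponents *)
Section Leads.
Variables (K : fieldType) (G : mgraph).
Variable le : rel 'X_{1..#|gvar G|}.
Hypothesis hle : good_order K le.
Local Notation expo := 'X_{1..#|gvar G|}.
Implicit Types (d : dart G) (p c : seq (dart G)) (S : {set edge G}).
Implicit Types x y a b : expo.
Local Notation zv x i := (expo_at x (gvz (inl i))).

Let hto : term_order le. Proof. by case: hle. Qed.
Let le_trans : transitive le. Proof. by case: hto. Qed.

Definition BG_lead_divides x : Prop :=
  exists f l, [/\ BG (K := K) (G := G) f, is_lead le f 'X_[l] & (l <= x)%MM].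

Lemma fundamental_lead_divides (T : finType) (u v : T -> gvar G)
    (w : T -> RG K G) x :
    (forall t, fundamental (pvar K (u t) * pvar K (v t)) (w t)) ->
    (forall t, u t != v t) ->
  (forall t, expo_at x (u t) = 0%N \/ expo_at x (v t) = 0%N) \/
  BG_lead_divides x.
Proof.
move=> fund uv; have [/forallP h|] :=
  boolP [forall t, (expo_at x (u t) == 0%N) || (expo_at x (v t) == 0%N)].
  by left=> t; have /orP[/eqP|/eqP] := h t; [left|right].
rewrite negb_forall => /existsP[t]; rewrite negb_or -!lt0n => /andP[xu xv].
right; exists (pvar K (u t) * pvar K (v t) - w t), (mon [:: u t; v t]); split.
- exact: BG_fundamental.
- rewrite -prod_mon !big_cons big_nil mulr1.
  by case: hle => _ lead _; apply: lead.
- apply: mon_le => [|v']; first by rewrite /= inE uv.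
  by rewrite !inE => /orP[]/eqP->.
Qed.

Lemma fundamental_free_or x : fundamental_free x \/ BG_lead_divides x.
Proof.
have yyN e : @gvy G (e, false) != gvy (e, true) by apply/eqP=> -[].
have [yy|] := @fundamental_lead_divides _ (fun e => gvy (e, false))
  (fun e => gvy (e, true)) _ x (@Fund_yy K G) yyN; last by right.
have [yt|] := @fundamental_lead_divides _ (@gvy G)
  (fun d => gvt d.1) _ x (@Fund_yt K G) (fun e => isT); last by right.
have [yz|] := @fundamental_lead_divides _ (@gvy G)
  (fun d => gvz (inl (dtgt d))) _ x (@Fund_yz K G) (fun e => isT);
  last by right.
have [tz|] := @fundamental_lead_divides _ (@gvt G)
  (fun e => gvz (inr e)) _ x (@Fund_tz K G) (fun e => isT); last by right.
by left.
Qed.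

Lemma le_zz_yy d : le (mon [:: gvz (inr d.1); gvz (inr d.1)])
                      (mon [:: gvy d; gvy (drev d)]).
Proof.
have : is_lead le ('X_[mon [:: gvy (d.1, false); gvy (d.1, true)]]
    - 'X_[mon [:: gvz (inr d.1); gvz (inr d.1)]] : RG K G)
    'X_[mon [:: gvy (d.1, false); gvy (d.1, true)]].
  rewrite -!prod_mon !big_cons !big_nil !mulr1 -expr2.
  by case: hle => _ lead _; apply: lead; apply: Fund_yy.
case/is_lead_binomialE => _; case: d => e [] //=.
rewrite /drev /= !mon_cons !addmA.
by rewrite (addmC U_(_)%MM U_(enum_rank (gvy (e, true)))%MM).
Qed.

(** Shrinking the first block keeps the first monomial the smaller one.  Moving
    one edge e = ij changes y_{ije} M <= z_e N into z_e M <= y_{jie} N: multiply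
    by y_{jie}, use z_e^2 <= y_{ije} y_{jie}, and cancel z_e. *)
Lemma lead_switch a b S1 S2 p :
    {in p, forall d, d.1 \in S2 -> d.1 \in S1} ->
    le (a + mon (dart_vars S1 p))%MM
       (b + mon (dart_vars (~: S1) (map (@drev G) p)))%MM ->
  le (a + mon (dart_vars S2 p))%MM
     (b + mon (dart_vars (~: S2) (map (@drev G) p)))%MM.
Proof.
rewrite !dart_vars_rev; elim: p a b => [|d p IHp] a b sub //=.
have subp : {in p, forall d, d.1 \in S2 -> d.1 \in S1}.
  by move=> d' d'p; apply: sub; rewrite inE d'p orbT.
have {}IHp a' b' := IHp a' b' subp.
rewrite !mon_cons !addmA => h; apply: IHp; move: h.
have := sub d (mem_head _ _); case: (d.1 \in S2) => [->//|_].
case: ifP => // d1 h.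
set L := mon _ in h *; set R := mon _ in h *.
set Z := U_(enum_rank (gvz (inr d.1)))%MM in h *.
set Y := U_(enum_rank (gvy d))%MM in h *; set Y' := U_(_)%MM.
rewrite -(term_order_add2r hto Z).
have zzyy : le (Z + Z)%MM (Y + Y')%MM.
  by have := le_zz_yy d; rewrite !mon_cons /mon !big_nil !addm0.
apply: (@le_trans (a + Y + L + Y')%MM).
  have -> : (a + Z + L + Z = (a + L) + (Z + Z))%MM.
    by apply/mnmP=> i; rewrite !mnmDE; lia.
  have -> : (a + Y + L + Y' = (a + L) + (Y + Y'))%MM.
    by apply/mnmP=> i; rewrite !mnmDE; lia.
  by rewrite term_order_add2l.
have -> : (b + Y' + R + Z = b + Z + R + Y')%MM.
  by apply/mnmP=> i; rewrite !mnmDE; lia.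
by rewrite term_order_add2r.
Qed.

(** A binomial of B_G attached to a nonempty walk is not zero: the two variables
    that the first dart contributes to its two monomials differ. *)
Lemma dart_vars_neq a b S d p :
    (forall v, edge_var v -> b (enum_rank v) = 0%N) ->
  (a + mon (dart_vars S (d :: p)))%MM
    != (b + mon (dart_vars (~: S) (map (@drev G) (d :: p))))%MM.
Proof.
move=> b0; pose v := if d.1 \in S then gvy d else gvz (inr d.1).
apply/eqP => /mnmP/(_ (enum_rank v)); rewrite !mnmDE !monE b0; last first.
  by rewrite /v; case: ifP.
rewrite (_ : count_mem v (dart_vars (~: S) _) = 0%N); last first.
  apply/count_memPn; rewrite dart_vars_rev; apply/mapP=> -[d' _].
  rewrite /v; case: ifP => dS; case: ifP => dS' // [].
    by move=> /(congr1 fst)/= ed; rewrite ed dS' in dS.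
  by move=> ed; rewrite ed dS' in dS.
by rewrite /= -/v eqxx; lia.
Qed.

(** A dart is positive because of [x] or of [y]; if its edge has no y-variable
    dividing [y], only [x] is left. *)
Lemma flow_edge_blocks x y d : reduced_pair x y -> flow_pos x y d ->
  d.1 \notin y_edges y -> d.1 \in y_edges x.
Proof.
move=> red posd; rewrite (y_edgesP red posd).
have : flow_pos y x (drev d) by rewrite flow_pos_swap drevK.
move=> /(y_edgesP (reduced_pair_sym red)) /= ->.
by move: posd; rewrite /flow_pos; lia.
Qed.

(** With the block [y_edges x] the first monomial divides [x]; with the smaller
    block [~: y_edges y] the second one divides [y].  By [lead_switch], the
    first monomial leads in the former case or the second in the latter. *)
Lemma flow_walk_lead x y a b d p :
    reduced_pair x y -> all (flow_pos x y) (d :: p) ->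
    (a + mon (dart_vars (y_edges x) (d :: p)) <= x)%MM ->
    (b + mon (dart_vars (y_edges y) (map (@drev G) (d :: p))) <= y)%MM ->
    (forall v, edge_var v -> b (enum_rank v) = 0%N) ->
    (forall S, S = y_edges x \/ S = ~: y_edges y ->
       BG (dart_binomial K a b S (d :: p))) ->
  BG_lead_divides x \/ BG_lead_divides y.
Proof.
move=> red pos ax by_ b0 inB.
have sub : {in d :: p, forall d', d'.1 \in ~: y_edges y -> d'.1 \in y_edges x}.
  by move=> d' /(allP pos) posd'; rewrite in_setC; apply: flow_edge_blocks.
have [le_tot _ _ _ _] := hto.
pose l S := (a + mon (dart_vars S (d :: p)))%MM.
pose r S := (b + mon (dart_vars (~: S) (map (@drev G) (d :: p))))%MM.
have lr S : l S != r S by apply: dart_vars_neq.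
case/orP: (le_tot (r (y_edges x)) (l (y_edges x))) => [le1|].
  left; exists (dart_binomial K a b (y_edges x) (d :: p)), (l (y_edges x)).
  split=> //; first by apply: inB; left.
  by apply: (is_lead_binomial hto) => //; apply: lr.
move/(lead_switch sub) => le2.
right; exists (dart_binomial K a b (~: y_edges y) (d :: p)), (r (~: y_edges y)).
split; [by apply: inB; right| |by rewrite /r setCK].
by apply: (is_lead_binomialC hto) => //; rewrite eq_sym; apply: lr.
Qed.

Lemma mon_le_cons i S p x : uniq [seq d.1 | d <- p] -> (0 < zv x i)%N ->
    {in dart_vars S p, forall v, 0 < expo_at x v}%N ->
  (zvert i + mon (dart_vars S p) <= x)%MM.
Proof.
move=> up xi xp; rewrite /zvert (mon_cons _ [::]) /mon big_nil addm0 -mon_cons.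
apply: mon_le => [|v]; first by rewrite /= vertex_notin_dart_vars dart_vars_uniq.
by rewrite inE => /predU1P[->//|/xp].
Qed.

(** The combinatorial heart: it supplies the hypothesis of
    [groebner_of_fibres] for B_G. *)
Lemma disjoint_fibre_lead x y : toric_fibre x y -> x != y ->
    (forall i, x i = 0%N \/ y i = 0%N) ->
  BG_lead_divides x \/ BG_lead_divides y.
Proof.
move=> fib neq dis.
have [fx|] := fundamental_free_or x; last by left.
have [fy|] := fundamental_free_or y; last by right.
have red : reduced_pair x y by split=> // v; apply: dis.
have red' := reduced_pair_sym red.
have [/existsP[d0 pos0]|] := boolP [exists d, flow_pos x y d]; last first.
  rewrite negb_exists => /forallP/(no_flow red) exy.
  by rewrite exy eqxx in neq.
(* Backward continuation is forward continuation for the exchanged pair, whose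
   flow is reversed. *)
have back d : flow_pos x y d -> (0 < zv y (dsrc d))%N \/
    exists2 d', flow_pos x y d' & dtgt d' = dsrc d.
  rewrite -{1}(drevK d) -flow_pos_swap => /(flow_extend red').
  rewrite dtgt_drev => -[|[d' pos' src']]; [by left | right].
  by exists (drev d'); rewrite -?flow_pos_swap ?dtgt_drev.
have pos_map p : all (flow_pos x y) p -> all (flow_pos y x) (map (@drev G) p).
  by rewrite all_map => /allP h; apply/allP=> d /h; rewrite /= flow_pos_swap.
have edge_map p : [seq d.1 | d <- map (@drev G) p] = [seq d.1 | d <- p].
  by rewrite -map_comp.
have [[c [gc pos]]|[d [p [gp pos src snk]]]] :=
  @pos_path_or_cycle G _ (flow_pos_rev red) (fun i => 0 < zv y i)%N
    (fun i => 0 < zv x i)%N (flow_extend red) back d0 pos0.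
  have uc := pos_uniq_edges (flow_pos_rev red) pos (gcycle_uniq gc).
  case: c gc pos uc => [//|d p] gc pos uc.
  apply: (flow_walk_lead (a := 0%MM) (b := 0%MM) red pos).
  - by rewrite add0m; apply: mon_le (flow_divides red pos); apply: dart_vars_uniq.
  - rewrite add0m; apply: mon_le (flow_divides red' (pos_map _ pos)).
    by apply: dart_vars_uniq; rewrite edge_map.
  - by move=> v _; rewrite mnm0E.
  - by move=> S _; apply: BG_cycle.
have up := pos_uniq_edges (flow_pos_rev red) pos (gpath_uniq gp).
have posd : flow_pos x y d by case/andP: pos.
have posl : flow_pos x y (last d p) by apply: (allP pos); rewrite mem_last.
(* Both blocks are nonempty: the ends of the path see a z-variable. *)
have lastN := flow_into_sink red posl snk.
have firstN : d.1 \notin y_edges y.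
  apply: (@flow_into_sink _ _ _ red' (drev d)); last by rewrite dtgt_drev.
  by rewrite flow_pos_swap drevK.
have pathB S : d.1 \in S -> (last d p).1 \notin S ->
    BG (dart_binomial K (zvert (dtgt (last d p))) (zvert (dsrc d)) S (d :: p)).
  move=> dS lS; apply: BG_path => //; apply/hasP.
    by exists d; rewrite ?mem_head.
  by exists (last d p); rewrite ?mem_last.
have sub d' : flow_pos x y d' -> d'.1 \notin y_edges y -> d'.1 \in y_edges x.
  exact: (flow_edge_blocks red).
apply: (flow_walk_lead red pos).
- exact: mon_le_cons up snk (flow_divides red pos).
- apply: mon_le_cons src (flow_divides red' (pos_map _ pos)).
  by rewrite edge_map.
- move=> v vE; rewrite /zvert monE; apply/count_memPn.
  by rewrite inE; apply: contraTneq vE => ->.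
- move=> S [] ->; apply: pathB => //; first exact: sub.
    by rewrite inE.
  by rewrite inE negbK; apply: contraR lastN; apply: sub.
Qed.


End Leads.

Theorem theorem2p9 (K : fieldType) (G : mgraph) (hG : connected G)
    (le : rel 'X_{1..#|gvar G|}) (hle : good_order K le) :
  groebner_basis le (@toric_ideal K G) (@BG K G).
Proof.
apply: (@groebner_of_fibres K _ _ (@toric_num G) (@toric_den G)).
- by case: hle.
- by move=> i; apply: mdeg_var.
- exact: toric_idealE.
- exact: BG_finite.
- exact: BG_in_toric_ideal.
move=> x y fib neq dis.
have [[f [l [? ? ?]]]|[f [l [? ? ?]]]] := disjoint_fibre_lead hle fib neq dis.
  by exists f, l; split=> //; left.
by exists f, l; split=> //; right.
Qed.
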